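(* Let $d\ge 1$, $m>0$, $R_0>0$, $s<-\frac{2}{d}$ and $\alpha>0$, and let $$G(c):=\frac{1}{1-s}\,c^s+\alpha c,\qquad g(c):=G(c)-G'(c)c=c^s\qquad (c>0).$$ Consider the radially symmetric evolution, under the system $$V=g(c)H,\qquad \partial^\square c=\Delta_\Gamma\big(G'(c)\big)+cHV,$$ of the sphere $\Gamma(0)=\partial B_{R_0}(0)\subset\mathbb{R}^{d+1}$ with spatially constant initial concentration of total mass $m$; that is, $\Gamma(t)=\partial B_{R(t)}(0)$ and $c(t)$ is constant in space with $c(t)=\frac{m}{\alpha_d}R(t)^{-d}$, where $R(t)>0$ and $R(0)=R_0$. This evolution $(\Gamma,c)$ exists for all times, i.e. the corresponding radius function $R$ is defined and positive on all of $[0,\infty)$ and $(\Gamma(t),c(t))$ satisfies the system for all $t$.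
   Context: $\alpha_d:=\mathcal{H}^d(\partial B_1(0))$ is the area of the unit sphere in $\mathbb{R}^{d+1}$. For an evolving hypersurface with global parameterization $\theta$ (here $\theta(t,z)=\frac{R(t)}{R_0}z$, $z\in\partial B_{R_0}(0)$) and outer unit normal $\nu$: the mean curvature is $H:=-\mathrm{div}_\Gamma\nu$ (so $H=-d/R(t)$ on $\partial B_{R(t)}(0)$), the total velocity is $V^{\mathrm{tot}}:=\partial_t\theta$, the normal velocity is $V:=V^{\mathrm{tot}}\cdot\nu$, $\nabla_\Gamma$ and $\Delta_\Gamma$ are the surface gradient and Laplace-Beltrami operator, and for a function $f$ of $t$ and the point of the reference surface, the normal time derivative is $\partial^\square f:=\partial_t f-V^{\mathrm{tot}}\cdot\nabla_\Gamma f$. *)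

(* Defs.v *)
From HB Require Import structures.
From mathcomp Require Import all_boot all_order all_algebra.
From mathcomp Require Import all_classical all_reals all_analysis.
From mathcomp Require Import ring.
Import Order.TTheory GRing.Theory Num.Theory.
Import numFieldNormedType.Exports.

Set Implicit Arguments.
Unset Strict Implicit.
Unset Printing Implicit Defensive.

Local Open Scope classical_set_scope.
Local Open Scope ring_scope.

(* The library norm on row vectors is the max norm; only the topology (hence
   the limits and derivatives) of that structure is used below. *)
Definition dotp (R : realType) n (u v : 'rV[R]_n) : R :=
  \sum_(i < n) u 0 i * v 0 i.

Definition enorm (R : realType) n (u : 'rV[R]_n) : R := Num.sqrt (dotp u u).

Definition eball (R : realType) n (r : R) : set 'rV[R]_n :=
  [set x | enorm x < r].

Definition esphere (R : realType) n (r : R) : set 'rV[R]_n :=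
  [set x | enorm x = r].

Section Hausdorff.
Context (R : realType) (n : nat).
Implicit Types A : set 'rV[R]_n.

(* The element 0 makes the diameter of the empty set 0 rather than -oo. *)
Definition ediam A : \bar R :=
  ereal_sup ([set 0%E] `|`
    [set e | exists x y, [/\ A x, A y & e = (enorm (x - y))%:E]]).

(* Volume of the unit ball of R^k, by the recursion
   omega_k = (2 pi / k) omega_(k-2). *)
Fixpoint unit_ball_vol (k : nat) : R :=
  match k with
  | 0 => 1
  | 1 => 2
  | (k'.+2) as k => 2 * pi / k%:R * unit_ball_vol k'
  end.

(* For k = 0 the empty set contributes 0 ^+ 0 = 1, so that only the case
   0 < k gives the usual Hausdorff measure. *)
Definition hausdorff_pre (k : nat) (delta : R) A : \bar R :=
  ereal_inf [set e | exists U : nat -> set 'rV[R]_n,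
    [/\ A `<=` \bigcup_i U i,
        (forall i, (ediam (U i) <= delta%:E)%E) &
        e = (\sum_(0 <= i <oo)
               (unit_ball_vol k / 2 ^+ k)%:E * ediam (U i) ^+ k)%E]].

Definition hausdorff (k : nat) A : \bar R :=
  ereal_sup [set hausdorff_pre k delta A | delta in [set delta | 0 < delta]].

End Hausdorff.

Definition sphere_area (R : realType) (d : nat) : R :=
  fine (hausdorff d (@esphere R d.+1 1)).

(* Calculus on a hypersurface Gamma of R^(d+1).  Functions and fields on Gamma
   are total functions on the ambient space; every notion below depends only
   on their values on Gamma. *)
Section SurfaceCalculus.
Context (R : realType) (d : nat).
Notation E := 'rV[R]_d.+1.
Implicit Types (Gamma Omega : set E) (f : E -> R) (X : E -> E).

Definition curve_in Gamma (x : E) (gamma : R -> E) (v : E) :=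
  [/\ forall h, Gamma (gamma h), gamma 0 = x & is_derive (0 : R) 1 gamma v].

Definition tangent Gamma (x : E) : set E :=
  [set v | exists gamma, curve_in Gamma x gamma v].

(* w is the tangent vector representing the differential of f at x. *)
Definition is_surface_grad Gamma f (x w : E) :=
  tangent Gamma x w /\
  forall gamma v, curve_in Gamma x gamma v ->
    is_derive (0 : R) 1 (f \o gamma) (dotp w v).

Definition surface_differentiable Gamma f :=
  forall x, Gamma x -> exists w, is_surface_grad Gamma f x w.

Definition surface_grad Gamma f (x : E) : E :=
  get [set w | is_surface_grad Gamma f x w].

Definition surface_differentiable_field Gamma X :=
  forall i, surface_differentiable Gamma (fun x => X x 0 i).

Definition surface_div Gamma X (x : E) : R :=
  \sum_(i < d.+1) surface_grad Gamma (fun y => X y 0 i) x 0 i.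

Definition laplace_beltrami Gamma f (x : E) : R :=
  surface_div Gamma (surface_grad Gamma f) x.

(* Gamma is the boundary of the region Omega. *)
Definition is_outer_unit_normal Omega Gamma (x n : E) :=
  [/\ enorm n = 1,
      forall v, tangent Gamma x v -> dotp n v = 0 &
      exists2 e : R, 0 < e & forall h, 0 < h < e -> ~ Omega (x + h *: n)].

Definition outer_unit_normal Omega Gamma (x : E) : E :=
  get [set n | is_outer_unit_normal Omega Gamma x n].

Definition mean_curvature Omega Gamma (x : E) : R :=
  - surface_div Gamma (outer_unit_normal Omega Gamma) x.

End SurfaceCalculus.

(* Derivative with respect to t in [0, +oo[; it is one-sided at t = 0. *)
Section TimeDerivative.
Context (R : realType) (V : normedModType R).

Definition time_quotients (f : R -> V) (t : R) :=
  (fun h : R => h^-1 *: (f (t + h) - f t)) @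
    within [set h | 0 <= t + h] (0 : R)^'.

Definition time_derivable (f : R -> V) (t : R) := cvg (time_quotients f t).

Definition time_derive (f : R -> V) (t : R) : V := lim (time_quotients f t).

End TimeDerivative.

(* An evolving hypersurface Gamma t, boundary of Omega t, with reference
   surface M and global parameterization theta t from M onto Gamma t.
   Scalar quantities are functions of the time t and of the point z of M. *)
Section EvolvingHypersurface.
Context (R : realType) (d : nat).
Notation E := 'rV[R]_d.+1.
Variables (M : set E) (Omega Gamma : R -> set E) (theta : R -> E -> E).

Definition normal (t : R) : E -> E := outer_unit_normal (Omega t) (Gamma t).

Definition curvature (t : R) (z : E) : R :=
  mean_curvature (Omega t) (Gamma t) (theta t z).

Definition total_velocity (t : R) (z : E) : E :=
  time_derive (fun u => theta u z) t.

Definition normal_velocity (t : R) (z : E) : R :=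
  dotp (total_velocity t z) (normal t (theta t z)).

Definition push (t : R) (f : E -> R) : E -> R := f \o pinv M (theta t).

Definition grad_at (t : R) (f : E -> R) (z : E) : E :=
  surface_grad (Gamma t) (push t f) (theta t z).

Definition laplace_at (t : R) (f : E -> R) (z : E) : R :=
  laplace_beltrami (Gamma t) (push t f) (theta t z).

Definition normal_time_derive (f : R -> E -> R) (t : R) (z : E) : R :=
  time_derive (fun u => f u z : R^o) t -
  dotp (total_velocity t z) (grad_at t (f t) z).

End EvolvingHypersurface.

Section System.
Context (R : realType).

Definition gfun (G : R -> R) (c : R) : R := G c - derive1 G c * c.

(* Besides the two equations, the fields say that theta parameterizes the
   hypersurfaces, that c is positive and that every derivative occurring in
   the equations exists (time_derive, surface_grad are total functions). *)
Record global_solution (d : nat) (G : R -> R) (M : set 'rV[R]_d.+1)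
    (Omega Gamma : R -> set 'rV[R]_d.+1)
    (theta : R -> 'rV[R]_d.+1 -> 'rV[R]_d.+1)
    (c : R -> 'rV[R]_d.+1 -> R) : Prop := GlobalSolution {
  sol_param : forall t, 0 <= t -> set_bij M (Gamma t) (theta t);
  sol_param0 : forall z, M z -> theta 0 z = z;
  sol_normal : forall t x, 0 <= t -> Gamma t x ->
    exists n, is_outer_unit_normal (Omega t) (Gamma t) x n;
  sol_normal_diff : forall t, 0 <= t ->
    surface_differentiable_field (Gamma t) (normal Omega Gamma t);
  sol_theta_diff : forall t z, 0 <= t -> M z ->
    time_derivable (fun u => theta u z) t;
  sol_c_gt0 : forall t z, 0 <= t -> M z -> 0 < c t z;
  sol_c_diff : forall t z, 0 <= t -> M z ->
    time_derivable (fun u => c u z : R^o) t;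
  sol_c_surface_diff : forall t, 0 <= t ->
    surface_differentiable (Gamma t) (push M theta t (c t));
  sol_G'c_surface_diff : forall t, 0 <= t ->
    surface_differentiable (Gamma t) (push M theta t (derive1 G \o c t));
  sol_G'c_surface_diff2 : forall t, 0 <= t ->
    surface_differentiable_field (Gamma t)
      (surface_grad (Gamma t) (push M theta t (derive1 G \o c t)));
  sol_velocity : forall t z, 0 <= t -> M z ->
    normal_velocity Omega Gamma theta t z =
    gfun G (c t z) * curvature Omega Gamma theta t z;
  sol_diffusion : forall t z, 0 <= t -> M z ->
    normal_time_derive M Gamma theta c t z =
    laplace_at M Gamma theta t (derive1 G \o c t) z +
    c t z * curvature Omega Gamma theta t z *
      normal_velocity Omega Gamma theta t z
}.

Definition Gdens (s alpha c : R) : R := (1 - s)^-1 * c `^ s + alpha * c.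

Lemma gfun_Gdens (s alpha c : R) : s < 0 -> 0 < c ->
  gfun (Gdens s alpha) c = c `^ s.
Proof.
move=> s0 c0.
have s1 : 1 - s != 0 by rewrite gt_eqF // subr_gt0 (lt_trans s0).
have D : is_derive c 1 (Gdens s alpha)
    ((1 - s)^-1 * (s * c `^ (s - 1)) + alpha).
  have := is_derive1_powR s c0 => Dp.
  have -> : Gdens s alpha =
      (1 - s)^-1 \*: (fun x : R => x `^ s) + alpha \*: (id : R -> R) by [].
  have : is_derive c 1
      ((1 - s)^-1 \*: (fun x : R => x `^ s) + alpha \*: (id : R -> R))
      ((1 - s)^-1 *: (s * c `^ (s - 1)) + alpha *: (1 : R)).
    exact: is_deriveD.
  by rewrite /GRing.scale /= mulr1.
rewrite /gfun derive1E derive_val /Gdens.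
have -> : c `^ s = c `^ (s - 1) * c.
  rewrite -{3}(powRr1 (ltW c0)) -powRD ?subrK //.
  by rewrite (gt_eqF c0) implybT.
by field.
Qed.

End System.

(* Main.v *)
Require Import Defs.
From mathcomp Require Import all_boot all_order all_algebra.
From mathcomp Require Import all_classical all_reals all_analysis.
From mathcomp Require Import measurable_realfun.
From mathcomp Require Import ring lra.
Import Order.TTheory GRing.Theory Num.Theory.
Import numFieldNormedType.Exports.
(** The system reduces to a scalar equation for the radius.  On the sphere of
radius [r] the unit normal is [x / r] and the mean curvature is [- d / r]; a
concentration that is constant in space has zero surface gradient and zero
surface Laplacian.  With [c = k * r ^- d], [k = m / alpha_d], the diffusion
equation is then the time derivative of [k * r ^- d], whatever [r] is, and the
velocity law becomes
    [r' = (k * r ^- d) ^ s * (- d / r) = - A * r ^ (q + 1)],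
where [A = d * k ^ s] and [q = - d * s - 2].  The assumption [s < - 2 / d] says
exactly that [q > 0].  Hence [r ^ (- q)] grows linearly, with slope [A * q], and
    [r t = (R0 ^ (- q) + A * q * t) ^ (- 1 / q)]
is positive and solves the equation for all [t >= 0]: the velocity tends to zero
so fast with the radius that the sphere does not vanish in finite time
([radius_ode_global_solution]).

The concentration is positive only if [alpha_d], a Hausdorff measure, is
positive and finite ([sphere_area_gt0]).

- Positivity.  A cover of the sphere covers in particular the graph over a small
  cube of [R^d]; projecting it to [R^d] and replacing each piece by a cube of side
  twice its diameter gives a countable cover of the small cube.  Such a cover has
  total volume at least that of the cube ([cube_cover_volume]), which bounds the
  sum of the [d]-th powers of the diameters from below.

- Finiteness.  The part of the sphere where a given coordinate, with a given
  sign, is at least [1 / (d + 1)] is a Lipschitz graph over the other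
  coordinates ([sphere_graph_lipschitz]); cutting these coordinates by a grid of
  mesh [1 / n] covers the sphere by a number of order [n ^ d] of pieces of
  diameter of order [1 / n].

The geometry of the sphere rests on the fact that its tangent space at [x],
defined by velocities of curves, is the orthogonal complement of [x]
([tangent_esphere]).  Surface gradients and the normal are then determined by
their defining properties, and it suffices to exhibit them. *)

Set Implicit Arguments.
Unset Strict Implicit.
Unset Printing Implicit Defensive.

Local Open Scope classical_set_scope.
Local Open Scope ring_scope.

(** * Covers of a cube by cubes *)

(** The inequality is an elementary substitute for Lebesgue measure in [R^n], by
induction on [n].  For each value [y] of the last coordinate, the cubes that meet
the hyperplane at height [y] induce a cover of an [n]-dimensional cube;
integrating over [y] the inequality for the slices multiplies each volume by at
most one more side length.  Only coordinates below [n] of the sequences [x] and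
[p i] matter, and the selector [P] is there because slicing discards cubes. *)
Lemma cube_cover_volume (R : realType) (n : nat) (a : R) (P : pred nat)
    (p : nat -> nat -> R) (rho : nat -> R) :
  0 <= a -> (forall i, 0 <= rho i) ->
  (forall x : nat -> R, (forall k, 0 <= x k <= a) ->
    exists2 i, P i & forall k, (k < n)%N -> `|x k - p i k| <= rho i) ->
  ((a ^+ n)%:E <= \sum_(i <oo | P i) ((2 * rho i) ^+ n)%:E)%E.
Proof.
move=> a0 rho0; elim: n P => [|n IHn] P cov.
  have [i Pi _] := cov (fun=> 0) (fun=> introT andP (conj (lexx _) a0)).
  apply: (@le_trans _ _ (\sum_(0 <= j < i.+1 | P j) ((2 * rho j) ^+ 0)%:E)%E).
    rewrite big_mkcond big_nat_recr//= Pi leeDr// sume_ge0// => j _.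
    by case: ifP => _; rewrite lee_fin.
  by apply: nneseries_lim_ge => j _ _; rewrite lee_fin.
pose slice (y : R) i := P i && (`|y - p i n| <= rho i).
pose I i := `[p i n - rho i, p i n + rho i]%classic : set R.
pose w i := if P i then (2 * rho i) ^+ n else 0.
have w0 i : 0 <= w i by rewrite /w; case: ifP => // _; rewrite exprn_ge0// mulr_ge0.
have slicecov y : 0 <= y <= a ->
    ((a ^+ n)%:E <= \sum_(i <oo) (w i * \1_(I i) y)%:E)%E.
  move=> ya; have := IHn (slice y).
  rewrite [X in (_ -> (_ <= X)%E) -> _]eseries_mkcond => H.
  apply: le_trans (H _) _.
    move=> x xa.
    have [|i Pi Hi] := cov (fun k => if k == n then y else x k).
      by move=> k; case: ifP.
    exists i.
      by rewrite /slice Pi /=; have := Hi n (ltnSn n); rewrite eqxx.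
    move=> k kn; have := Hi k (ltnW kn).
    by rewrite (ltn_eqF kn).
  rewrite le_eqVlt; apply/orP; left; apply/eqP; apply: eq_eseriesr => i _.
  rewrite /slice /w indicE /I mem_setE in_itv/= distrC ler_distlC.
  by case: (P i) => /=; [case: ifP; rewrite ?mulr1 ?mulr0 | rewrite mul0r].
have mI i : measurable (I i) by exact: measurable_itv.
pose D := `[0, a]%classic : set R.
have mD : measurable D by exact: measurable_itv.
have mf i : measurable_fun D ((fun y => (w i * \1_(I i) y)%:E) : R -> \bar R).
  apply/measurable_EFinP; apply: measurable_funM => //.
have f0 i y : D y -> (0 <= (w i * \1_(I i) y)%:E)%E.
  by move=> _; rewrite lee_fin mulr_ge0// indicE.
have muD : lebesgue_measure D = a%:E.
  rewrite /D lebesgue_measure_itv/= lte_fin oppr0 addr0.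
  by case: ltgtP a0 => // <-.
have -> : (a ^+ n.+1)%:E =
    (\int[lebesgue_measure]_(y in D) (cst (a ^+ n)%:E) y)%E.
  by rewrite integral_cst// exprSr EFinM; congr (_ * _)%E; rewrite -muD.
(* Integrate the slice inequality, then exchange sum and integral. *)
apply: le_trans (_ : (\int[lebesgue_measure]_(y in D)
    \sum_(i <oo) (w i * \1_(I i) y)%:E <= _)%E).
  apply: ge0_le_integral => //.
  - by move=> y _; rewrite lee_fin exprn_ge0.
  - apply: (@ge0_emeasurable_sum _ _ _ D
      (fun i y => (w i * \1_(I i) y)%:E) xpredT) => [i y Dy _|i _].
      exact: f0.
    exact: mf.
rewrite integral_nneseries// [leRHS]eseries_mkcond.
apply: lee_nneseries => [i _ _|i _]; first by apply: integral_ge0 => y; exact: f0.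
under eq_integral do rewrite EFinM.
have mI1 : measurable_fun D ((fun y => (\1_(I i) y)%:E) : R -> \bar R).
  by apply/measurable_EFinP.
rewrite ge0_integralZl//; last exact: w0.
rewrite integral_indic//; last exact: mI.
rewrite /w; case: (P i); last by rewrite mul0e.
rewrite exprSr EFinM lee_pmul// ?lee_fin ?exprn_ge0 ?mulr_ge0//.
apply: (@le_trans _ _ (lebesgue_measure (I i))).
  apply: le_measure; last exact: subIsetl.
    by rewrite inE; apply: measurableI; [exact: mI|exact: mD].
  by rewrite inE; exact: mI.
rewrite /I lebesgue_measure_itv/= lte_fin.
by case: ifP => _; rewrite ?lee_fin ?mulr_ge0//; lra.
Qed.

(** * Euclidean norm and Hausdorff premeasures *)

Section EuclideanNorm.
Context (R : realType) (n : nat).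
Implicit Types u v x : 'rV[R]_n.

Lemma dotpp_ge0 u : 0 <= dotp u u.
Proof. by apply: sumr_ge0 => i _; rewrite -expr2 sqr_ge0. Qed.

Lemma enorm_ge0 u : 0 <= enorm u.
Proof. exact: sqrtr_ge0. Qed.

Lemma enorm_sqr u : enorm u ^+ 2 = dotp u u.
Proof. by rewrite sqr_sqrtr// dotpp_ge0. Qed.

Lemma coord_le_enorm u i : `|u 0 i| <= enorm u.
Proof.
rewrite -sqrtr_sqr /enorm ler_sqrt ?dotpp_ge0// /dotp (bigD1 i)//= expr2 lerDl.
by apply: sumr_ge0 => j _; rewrite -expr2 sqr_ge0.
Qed.

Lemma enorm_le_sum u : enorm u <= \sum_i `|u 0 i|.
Proof.
have s0 : 0 <= \sum_i `|u 0 i| by exact: sumr_ge0.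
rewrite -(ger0_norm s0) -sqrtr_sqr /enorm ler_sqrt ?sqr_ge0//.
rewrite expr2 mulr_suml; apply: ler_sum => i _.
rewrite -[leLHS]ger0_norm -?expr2 ?sqr_ge0// normrX expr2 ler_wpM2l//.
by rewrite (bigD1 i)//= lerDl sumr_ge0.
Qed.

End EuclideanNorm.

Section HausdorffBounds.
Context (R : realType) (n : nat).
Implicit Types (A U : set 'rV[R]_n).

Lemma ediam_ge0 U : (0 <= ediam U)%E.
Proof. by apply: ereal_sup_ubound; left. Qed.

Lemma enorm_le_ediam U x y : U x -> U y -> ((enorm (x - y))%:E <= ediam U)%E.
Proof. by move=> Ux Uy; apply: ereal_sup_ubound; right; exists x, y. Qed.

Lemma ediam_le U (e : R) : 0 <= e ->
  (forall x y, U x -> U y -> enorm (x - y) <= e) -> (ediam U <= e%:E)%E.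
Proof.
move=> e0 H; apply: ge_ereal_sup => _ [->|[x [y [Ux Uy ->]]]];
  by rewrite lee_fin// H.
Qed.

Lemma ediam0 : ediam (set0 : set 'rV[R]_n) = 0%E.
Proof.
by apply/eqP; rewrite eq_le ediam_ge0 andbT; apply: ediam_le.
Qed.

(** The recursion goes down by two, so two consecutive values are carried. *)
Lemma unit_ball_vol_gt0 k : 0 < unit_ball_vol R k.
Proof.
suff : 0 < unit_ball_vol R k /\ 0 < unit_ball_vol R k.+1 by case.
elim: k => [|k [IH0 IH1]]; first by split=> /=.
by split=> //=; rewrite !mulr_gt0 ?invr_gt0 ?ltr0n ?pi_gt0.
Qed.

(** Finite covers are padded with empty sets, which contribute [0 ^ k] to the
sum: this is zero because [0 < k]. *)
Lemma hausdorff_pre_finite_cover (k : nat) (delta e : R) A (T : finType)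
    (U : T -> set 'rV[R]_n) :
  (0 < k)%N -> 0 <= e -> e <= delta ->
  A `<=` \bigcup_t U t ->
  (forall t x y, U t x -> U t y -> enorm (x - y) <= e) ->
  (hausdorff_pre k delta A
    <= (#|T|%:R * (unit_ball_vol R k / 2 ^+ k * e ^+ k))%:E)%E.
Proof.
move=> k0 e0 edelta AU Ue.
pose V (i : nat) := if insub i is Some j then U (@enum_val T predT j) else set0.
have Ve i : (ediam (V i) <= e%:E)%E.
  rewrite /V; case: insubP => [j _ _|_]; last by rewrite ediam0 lee_fin.
  by apply: ediam_le => // x y; exact: Ue.
have w0 : 0 <= unit_ball_vol R k / 2 ^+ k.
  by rewrite divr_ge0// ltW// unit_ball_vol_gt0.
apply: ge_ereal_inf; eexists.
  exists V; split=> //.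
    move=> x /AU[t _ Ut]; exists (enum_rank t) => //.
    by rewrite /V valK enum_rankK.
  by move=> i; rewrite (le_trans (Ve i))// lee_fin.
rewrite (nneseries_split 0%N #|T|); last first.
  by move=> i _; rewrite mule_ge0 ?lee_fin// expe_ge0// ediam_ge0.
rewrite [X in (_ + X)%E]eseries0 ?adde0; last first.
  move=> i Ti _; rewrite /V insubF; last by rewrite add0n in Ti; rewrite ltnNge Ti.
  by rewrite ediam0 -EFin_expe expr0n eqn0Ngt k0 mule0.
have -> : (#|T|%:R * (unit_ball_vol R k / 2 ^+ k * e ^+ k))%:E =
    (\sum_(i < #|T|) (unit_ball_vol R k / 2 ^+ k * e ^+ k)%:E)%E.
  by rewrite sumEFin sumr_const card_ord mulr_natl.
rewrite add0n big_mkord.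
apply: lee_sum => i _; rewrite [leRHS]EFinM lee_pmul ?lee_fin ?expe_ge0 ?ediam_ge0//.
rewrite EFin_expe; elim: (k) => // l IH; rewrite !expeS.
by rewrite lee_pmul ?expe_ge0 ?ediam_ge0.
Qed.

End HausdorffBounds.

(** * The area of the unit sphere is positive and finite *)

Section SphereArea.
Context (R : realType) (d : nat).
Context (d0 : (0 < d)%N).

(** The sphere contains the graph of [x |-> sqrt (1 - |x|^2)] over the cube of
side [1 / d], since [|x|^2 <= d * d^-2 <= 1] there.  The coordinate projection
does not increase distances, so a piece of diameter [rho] projects into a cube of
side [2 * rho] centred at the projection of any of its points. *)
Lemma hausdorff_pre_sphere_ge (delta : R) :
  ((unit_ball_vol R d / 2 ^+ d * (d%:R^-1 / 2) ^+ d)%:E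
    <= hausdorff_pre d delta (@esphere R d.+1 1))%E.
Proof.
have dR0 : 0 < d%:R :> R by rewrite ltr0n.
set w := unit_ball_vol R d / 2 ^+ d.
have w0 : 0 <= w by rewrite divr_ge0// ltW// unit_ball_vol_gt0.
apply: le_ereal_inf_tmp => _ [U [cov Udelta ->]].
pose P i := `[< U i !=set0 >].
pose rho i := fine (ediam (U i)).
have rhoE i : (rho i)%:E = ediam (U i).
  rewrite fineK// ge0_fin_numE ?ediam_ge0//.
  by rewrite (le_lt_trans (Udelta i))// ltry.
have rho0 i : 0 <= rho i by rewrite -lee_fin rhoE ediam_ge0.
pose p i k := (xget 0 (U i)) 0 (inord k : 'I_d.+1).
have a0 : 0 <= d%:R^-1 :> R by rewrite invr_ge0 ler0n.
have : ((d%:R^-1 ^+ d)%:E <= \sum_(i <oo | P i) ((2 * rho i) ^+ d)%:E)%E.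
  apply: (@cube_cover_volume R d d%:R^-1 P p rho a0 rho0) => x xa.
  pose q := \sum_(k < d) x k ^+ 2.
  have q1 : q <= 1.
    apply: (@le_trans _ _ (\sum_(k < d) d%:R^-1)); last first.
      by rewrite sumr_const card_ord -[leLHS]mulr_natl divff// gt_eqF.
    apply: ler_sum => k _; have /andP[x0 xle] := xa k.
    rewrite (le_trans _ xle)// expr2 ler_piMr// (le_trans xle)//.
    by rewrite invf_le1// ler1n.
  pose v : 'rV[R]_d.+1 :=
    \row_j (if (j < d)%N then x j else Num.sqrt (1 - q)).
  have Sv : esphere 1 v.
    rewrite /esphere /= /enorm -[RHS]sqrtr1; congr Num.sqrt.
    rewrite /dotp big_ord_recr/= !mxE ltnn -expr2 sqr_sqrtr ?subr_ge0//.
    rewrite addrC -[RHS](subrK q); congr (_ + _); apply: eq_bigr => k _.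
    by rewrite !mxE /= ltn_ord expr2.
  have [i _ Uv] := cov v Sv.
  exists i; first by apply/asboolP; exists v.
  move=> k kd.
  have Ux : U i (xget 0 (U i)) by apply: xgetPex; exists v.
  have := enorm_le_ediam Uv Ux; rewrite -rhoE lee_fin; apply: le_trans.
  have := coord_le_enorm (v - xget 0 (U i)) (inord k).
  have kE : nat_of_ord (inord k : 'I_d.+1) = k by rewrite inordK// ltnW.
  by rewrite !mxE kE kd.
rewrite eseries_mkcond => le_series.
have c0 : 0 <= w / 2 ^+ d by rewrite divr_ge0.
have -> : w * (d%:R^-1 / 2) ^+ d = w / 2 ^+ d * d%:R^-1 ^+ d.
  by rewrite exprMn !exprVn -mulrA [in RHS](mulrC (_ ^-1)).
rewrite EFinM; apply: (@le_trans _ _ ((w / 2 ^+ d)%:E *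
    \sum_(i <oo) if P i then ((2 * rho i) ^+ d)%:E else 0)%E).
  by rewrite lee_wpmul2l// lee_fin.
have t0 i : (0 <= if P i then ((2 * rho i) ^+ d)%:E else 0)%E.
  by case: ifP => // _; rewrite lee_fin exprn_ge0// mulr_ge0.
rewrite -nneseriesZl//.
apply: lee_nneseries => [i _ _|i _]; first by rewrite mule_ge0.
case: ifP => _; last by rewrite mule0 mule_ge0 ?lee_fin// expe_ge0// ediam_ge0.
by rewrite -rhoE -EFin_expe -!EFinM lee_fin exprMn mulrA divfK// expf_neq0.
Qed.

Lemma hausdorff_sphere_gt0 : (0 < hausdorff d (@esphere R d.+1 1))%E.
Proof.
apply: (@lt_le_trans _ _
    (unit_ball_vol R d / 2 ^+ d * (d%:R^-1 / 2) ^+ d)%:E).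
  rewrite lte_fin mulr_gt0 ?divr_gt0 ?unit_ball_vol_gt0// ?exprn_gt0//.
  by rewrite divr_gt0// invr_gt0 ltr0n.
apply: le_trans (hausdorff_pre_sphere_ge 1) _.
by apply: ereal_sup_ubound; exists 1 => //=; exact: ltr01.
Qed.

Lemma sphere_coord_le1 (x : 'rV[R]_d.+1) i : enorm x = 1 -> `|x 0 i| <= 1.
Proof. by move=> <-; exact: coord_le_enorm. Qed.

Lemma sphere_large_coord (x : 'rV[R]_d.+1) : enorm x = 1 ->
  exists j, d.+1%:R^-1 <= `|x 0 j|.
Proof.
move=> x1; apply/existsP; apply: contraT; rewrite negb_exists => /forallP H.
have : dotp x x < 1.
  apply: (@lt_le_trans _ _ (\sum_(j < d.+1) d.+1%:R^-1)); last first.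
    by rewrite sumr_const card_ord -[leLHS]mulr_natl divff// pnatr_eq0.
  apply: ltr_sum => [|j _]; first by apply/hasP; exists ord0; rewrite ?mem_index_enum.
  have := H j; rewrite -ltNge; apply: le_lt_trans.
  rewrite -[leLHS]ger0_norm -?expr2 ?sqr_ge0// normrX expr2.
  by rewrite ler_piMr// sphere_coord_le1.
by rewrite -enorm_sqr x1 expr1n ltxx.
Qed.

(** From [|x|^2 = |y|^2], the difference [(x j - y j) * (x j + y j)] is minus the
sum of the same products over the other coordinates.  The factor [x j + y j] is
at least [2 / (d + 1)] in absolute value because both terms have the same sign,
and the other factors are at most [2]. *)
Lemma sphere_graph_lipschitz (x y : 'rV[R]_d.+1) (j : 'I_d.+1) (b : bool) (e : R) :
  enorm x = 1 -> enorm y = 1 ->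
  d.+1%:R^-1 <= (-1) ^+ b * x 0 j -> d.+1%:R^-1 <= (-1) ^+ b * y 0 j ->
  (forall k, `|x 0 (lift j k) - y 0 (lift j k)| <= e) ->
  enorm (x - y) <= (d * d.+2)%:R * e.
Proof.
move=> x1 y1 xj yj H.
have D0 : 0 < d.+1%:R :> R by rewrite ltr0n.
have sumH : \sum_(k < d) `|x 0 (lift j k) - y 0 (lift j k)| <= d%:R * e.
  rewrite mulr_natl -[X in _ *+ X]card_ord -sumr_const.
  exact: ler_sum.
have : dotp x x - dotp y y = 0 by rewrite -!enorm_sqr x1 y1 subrr.
rewrite /dotp -sumrB (bigD1_ord j)//= => /eqP; rewrite addr_eq0 => /eqP E.
have Ej : `|x 0 j - y 0 j| * (2 / d.+1%:R) <= 2 * (d%:R * e).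
  apply: (@le_trans _ _ `|x 0 j * x 0 j - y 0 j * y 0 j|).
    have -> : x 0 j * x 0 j - y 0 j * y 0 j = (x 0 j - y 0 j) * (x 0 j + y 0 j).
      by ring.
    rewrite normrM ler_wpM2l//.
    have -> : `|x 0 j + y 0 j| = `|(-1) ^+ b * x 0 j + (-1) ^+ b * y 0 j|.
      by rewrite -mulrDr normrM normrX normrN1 expr1n mul1r.
    apply: le_trans (ler_norm _).
    by rewrite (_ : 2 / _ = d.+1%:R^-1 + d.+1%:R^-1) ?lerD//; ring.
  rewrite E normrN; apply: (le_trans (ler_norm_sum _ _ _)).
  apply: (@le_trans _ _
      (\sum_(k < d) 2 * `|x 0 (lift j k) - y 0 (lift j k)|)); last first.
    by rewrite -mulr_sumr ler_wpM2l.
  apply: ler_sum => k _.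
  set s := x 0 _; set t := y 0 _.
  have -> : s * s - t * t = (s + t) * (s - t) by ring.
  rewrite normrM ler_wpM2r// (le_trans (ler_normD _ _))//.
  have := sphere_coord_le1 (lift j k) x1; have := sphere_coord_le1 (lift j k) y1.
  rewrite -/s -/t; lra.
apply: (le_trans (enorm_le_sum _)).
rewrite (bigD1_ord j)//=; under eq_bigr do rewrite !mxE; rewrite !mxE.
have : `|x 0 j - y 0 j| <= d.+1%:R * (d%:R * e).
  rewrite -(ler_pM2r (_ : 0 < 2 / d.+1%:R)) ?divr_gt0//.
  apply: (le_trans Ej); rewrite le_eqVlt; apply/orP; left; apply/eqP.
  by field; rewrite lt0r_neq0.
rewrite natrM -[d.+2]addn1 natrD; move: sumH; set S := \sum_(_ < _) _ ; lra.
Qed.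

Lemma exists_grid_point (n : nat) (y : R) : `|y| <= 1 ->
  exists k : 'I_n.+1, `|(y + 1) / 2 * n%:R - k%:R| <= 1.
Proof.
rewrite ler_norml => /andP[y0 y1]; set z := _ * n%:R.
have z0 : 0 <= z by rewrite mulr_ge0// divr_ge0//; lra.
have zn : z <= n%:R by rewrite ler_piMl//; lra.
have tz : (Num.trunc z)%:R <= z by rewrite Num.Theory.truncn_le.
have zt := Num.Theory.truncnS_gt z.
have tn : (Num.trunc z < n.+1)%N.
  by rewrite ltnS -(ler_nat R) (le_trans tz).
exists (Ordinal tn) => /=; move: zt; rewrite -natr1 => zt.
rewrite ler_norml; lra.
Qed.

(** The bound does not depend on [delta]: the number [2 (d + 1) (n + 1) ^ d] of
pieces compensates the [d]-th power [(K / n) ^ d] of the bound on their diameters,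
as [(n + 1) / n <= 2].  A piece is given by a coordinate [j] that is large, its
sign, and the grid cell of the other coordinates. *)
Lemma hausdorff_pre_sphere_le (delta : R) : 0 < delta ->
  (hausdorff_pre d delta (@esphere R d.+1 1)
    <= (unit_ball_vol R d / 2 ^+ d *
        ((d.+1 * 2)%:R * (2 * (4 * (d * d.+2)%:R)) ^+ d))%:E)%E.
Proof.
move=> delta0; set K := 4 * (d * d.+2)%:R : R.
have K0 : 0 <= K by rewrite mulr_ge0.
(* A mesh so fine that the diameter bound [K / n] is at most [delta]. *)
pose n := (Num.bound (K / delta)).+1.
have n0 : 0 < n%:R :> R by rewrite ltr0n.
have Kn : K / n%:R <= delta.
  rewrite ler_pdivrMr// mulrC -ler_pdivrMr// /n -natr1.
  have := @archi_boundP R (K / delta) (divr_ge0 K0 (ltW delta0)); lra.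
pose T := ('I_d.+1 * bool * {ffun 'I_d -> 'I_n.+1})%type.
pose U (t : T) : set 'rV[R]_d.+1 := [set x | [/\ enorm x = 1,
  d.+1%:R^-1 <= (-1) ^+ t.1.2 * x 0 t.1.1 &
  forall k, `|(x 0 (lift t.1.1 k) + 1) / 2 * n%:R - (t.2 k)%:R| <= 1]].
apply: le_trans (@hausdorff_pre_finite_cover R d.+1 d delta (K / n%:R)
    _ T U d0 (divr_ge0 K0 (ltW n0)) Kn _ _) _.
- move=> x x1; have [j xj] := sphere_large_coord x1.
  have [f Hf] : exists f : {ffun 'I_d -> 'I_n.+1}, forall k,
      `|(x 0 (lift j k) + 1) / 2 * n%:R - (f k)%:R| <= 1.
    have /choice[f Hf] := fun k =>
      exists_grid_point n (sphere_coord_le1 (lift j k) x1).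
    by exists (finfun f) => k; rewrite ffunE.
  exists (j, x 0 j < 0, f) => //; split => //=.
  by rewrite -normrEsign.
- move=> [[j b] f] x y [x1 xj xf] [y1 yj yf].
  rewrite /K mulrAC mulrC; apply: sphere_graph_lipschitz xj yj _ => // k.
  have := xf k; have := yf k; rewrite /=.
  set s := x 0 _; set t := y 0 _; set m := (f k)%:R => Ht Hs.
  have : `|(s - t) / 2 * n%:R| <= 2.
    rewrite (_ : _ * n%:R = ((s + 1) / 2 * n%:R - m) - ((t + 1) / 2 * n%:R - m));
      last by field.
    by rewrite (le_trans (ler_normB _ _))//; lra.
  rewrite !normrM normfV !normr_nat => H.
  rewrite ler_pdivlMr//; lra.
rewrite lee_fin mulrCA ler_wpM2l//.
  by rewrite divr_ge0// ltW// unit_ball_vol_gt0.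
rewrite !card_prod card_bool card_ffun !card_ord natrM -mulrA ler_wpM2l//.
rewrite natrX -exprMn lerXn2r ?nnegrE ?mulr_ge0 ?invr_ge0//.
rewrite mulrCA mulrC ler_wpM2r// -natr1 ler_pdivrMr//.
have : 1 <= n%:R :> R by rewrite ler1n.
lra.
Qed.

Lemma hausdorff_sphere_ltoo : (hausdorff d (@esphere R d.+1 1) < +oo)%E.
Proof.
apply: le_lt_trans (ltry (unit_ball_vol R d / 2 ^+ d *
        ((d.+1 * 2)%:R * (2 * (4 * (d * d.+2)%:R)) ^+ d))).
by apply: ge_ereal_sup => _ [delta delta0 <-]; exact: hausdorff_pre_sphere_le.
Qed.

Lemma sphere_area_gt0 : 0 < sphere_area R d.
Proof. by rewrite fine_gt0// hausdorff_sphere_gt0 hausdorff_sphere_ltoo. Qed.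

End SphereArea.

(** * Scalar product and derivatives of curves *)

Section DotProduct.
Context (R : realType) (n : nat).
Implicit Types (u v w : 'rV[R]_n) (a : R).

Lemma dotpC u v : dotp u v = dotp v u.
Proof. by apply: eq_bigr => i _; rewrite mulrC. Qed.

Lemma dotpDl u v w : dotp (u + v) w = dotp u w + dotp v w.
Proof. by rewrite -big_split; apply: eq_bigr => i _; rewrite mxE mulrDl. Qed.

Lemma dotpZl a u v : dotp (a *: u) v = a * dotp u v.
Proof. by rewrite mulr_sumr; apply: eq_bigr => i _; rewrite mxE mulrA. Qed.

Lemma dotpDr u v w : dotp u (v + w) = dotp u v + dotp u w.
Proof. by rewrite dotpC dotpDl !(dotpC u). Qed.

Lemma dotpZr a u v : dotp u (a *: v) = a * dotp u v.
Proof. by rewrite dotpC dotpZl dotpC. Qed.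

Lemma dotpBl u v w : dotp (u - v) w = dotp u w - dotp v w.
Proof. by rewrite dotpDl -scaleN1r dotpZl mulN1r. Qed.

Lemma dotpBr u v w : dotp u (v - w) = dotp u v - dotp u w.
Proof. by rewrite dotpC dotpBl !(dotpC u). Qed.

Lemma dotp0l u : dotp 0 u = 0.
Proof. by rewrite -(scale0r 0) dotpZl mul0r. Qed.

Lemma dotp_delta u i : dotp (delta_mx 0 i) u = u 0 i.
Proof.
rewrite /dotp (bigD1 i)//= big1 => [|j ji]; first by rewrite mxE !eqxx mul1r addr0.
by rewrite mxE (negbTE ji) andbF mul0r.
Qed.

Lemma dotpp_eq0 u : dotp u u = 0 -> u = 0.
Proof.
move=> u0; apply/rowP => i; rewrite mxE; apply/eqP; rewrite -normr_eq0.
rewrite eq_le normr_ge0 andbT (le_trans (coord_le_enorm u i))//.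
by rewrite /enorm u0 sqrtr0.
Qed.

Lemma enormZ a u : enorm (a *: u) = `|a| * enorm u.
Proof.
by rewrite /enorm dotpZl dotpZr mulrA -expr2 sqrtrM ?sqr_ge0// sqrtr_sqr.
Qed.

End DotProduct.

Section RowDerivatives.
Context (R : realType) (n : nat).
Implicit Types (gamma : R -> 'rV[R]_n) (v : 'rV[R]_n).

Lemma is_derive_rowP gamma v (t : R) :
  is_derive t 1 gamma v <->
  forall i, is_derive t (1 : R) (fun h => gamma h 0 i) (v 0 i).
Proof.
split=> [[dg eg] i|H].
  have di := (derivable_mxP gamma t 1).1 dg 0 i.
  by apply: DeriveDef => //; rewrite -eg derive_mx// mxE.
have dg : derivable gamma t 1.
  by apply/derivable_mxP => k i; rewrite ord1; have [] := H i.
apply: DeriveDef => //; rewrite derive_mx//; apply/rowP => i; rewrite mxE.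
by have [] := H i.
Qed.

Lemma is_derive_dotpp gamma v (t : R) :
  is_derive t (1 : R) gamma v ->
  is_derive t (1 : R) (fun h => dotp (gamma h) (gamma h))
    (2 * dotp (gamma t) v).
Proof.
move=> /is_derive_rowP H.
have -> : (fun h => dotp (gamma h) (gamma h)) =
    \sum_(i < n) (fun h => gamma h 0 i) * (fun h => gamma h 0 i).
  by apply/funext => h; rewrite fct_sumE.
apply: is_derive_eq; rewrite mulr_sumr; apply: eq_bigr => i _.
by rewrite /GRing.scale /=; ring.
Qed.

End RowDerivatives.

(** * Surface calculus on a sphere *)

Section SphereCalculus.
Context (R : realType) (d : nat) (r : R).
Hypothesis r0 : 0 < r.
Notation E := 'rV[R]_d.+1.
Notation S := (@esphere R d.+1 r).
Implicit Types (f g : E -> R) (x v w : E).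

Lemma esphereP x : S x <-> dotp x x = r ^+ 2.
Proof.
rewrite -enorm_sqr /esphere/=; split => [->//|/eqP].
by rewrite eqrXn2 ?enorm_ge0 ?ltW// => /eqP.
Qed.

(** Differentiating [|gamma|^2 = r^2] gives one direction.  Conversely, for [v]
orthogonal to [x], the curve [h |-> r * (x + h v) / |x + h v|] stays on the sphere
and has velocity [v]: indeed [|x + h v|^2 = r^2 + h^2 |v|^2] is stationary at
[h = 0]. *)
Lemma tangent_esphere x v : S x -> tangent S x v <-> dotp x v = 0.
Proof.
move=> Sx; split.
  move=> [gamma [gS g0 dg]].
  have := is_derive_dotpp dg; rewrite g0.
  have -> : (fun h => dotp (gamma h) (gamma h)) = cst (r ^+ 2).
    by apply/funext => h; apply/esphereP.
  move=> [_]; rewrite derive_cst => /esym/eqP.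
  by rewrite mulf_eq0 pnatr_eq0/= => /eqP.
move=> xv.
pose N (h : R) := r ^+ 2 + dotp v v * h ^+ 2.
have N0 h : 0 < N h.
  by rewrite /N ltr_wpDr ?exprn_gt0// mulr_ge0 ?sqr_ge0// dotpp_ge0.
pose phi (h : R) := r * (Num.sqrt (N h))^-1.
have N0E : N 0 = r ^+ 2 by rewrite /N expr0n mulr0 addr0.
have phi0 : phi 0 = 1.
  by rewrite /phi N0E sqrtr_sqr gtr0_norm// divff// gt_eqF.
have dN : is_derive (0 : R) 1 N 0.
  have -> : N = cst (r ^+ 2) + dotp v v \*: (@id R ^+ 2) by apply/funext => h.
  by apply: is_derive_eq; rewrite /GRing.scale/= expr1 !(mulr0, mul0r, addr0).
have dphi : is_derive (0 : R) 1 phi 0.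
  have dS : is_derive (0 : R) 1 (Num.sqrt \o N) 0.
    have dsq := is_derive1_sqrt (N0 0).
    by have := is_derive1_comp dsq dN; rewrite mulr0.
  have nz : (Num.sqrt \o N) 0 != 0 by rewrite /= gt_eqF// sqrtr_gt0.
  have dV := is_deriveV nz dS.
  have -> : phi = r \*: (fun h => ((Num.sqrt \o N) h)^-1) by [].
  by apply: is_derive_eq; rewrite !scaler0.
exists (fun h => phi h *: (x + h *: v)); split.
- move=> h; apply/esphereP; rewrite dotpZl dotpZr dotpDl !dotpDr !dotpZl !dotpZr.
  rewrite [dotp v x]dotpC xv (esphereP x).1//.
  rewrite (_ : _ + _ = N h); last by rewrite /N; ring.
  rewrite /phi mulrA -expr2 exprMn exprVn sqr_sqrtr ?ltW//.
  by rewrite divfK// gt_eqF.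
- by rewrite phi0 scale0r addr0 scale1r.
- apply/is_derive_rowP => i.
  have -> : (fun h => (phi h *: (x + h *: v)) 0 i) =
      phi * (cst (x 0 i) + v 0 i \*: @id R).
    by apply/funext => h; rewrite !mxE /= /GRing.scale/= [h * _]mulrC.
  apply: is_derive_eq; rewrite phi0 /GRing.scale/=.
  by rewrite !(mulr0, addr0, add0r, mulr1, mul1r).
Qed.

(** Two gradients have the same scalar product with every tangent vector, in
particular with their difference, which is tangent since the tangent space is
linear. *)
Lemma is_surface_grad_unique f x w : S x ->
  is_surface_grad S f x w -> surface_grad S f x = w.
Proof.
move=> Sx [tw gw]; apply: get_unique => [|w' [tw' gw']]; first by split.
apply/eqP; rewrite -subr_eq0; apply/eqP/dotpp_eq0.
have /tangent_esphere[//|gamma c] : dotp x (w' - w) = 0.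
  by rewrite dotpBr !(tangent_esphere _ Sx).1// subrr.
have [_ e] := gw _ _ c; have [_ e'] := gw' _ _ c.
by rewrite dotpBl -e -e' subrr.
Qed.

Lemma eq_is_surface_grad f g x w : (forall y, S y -> f y = g y) ->
  is_surface_grad S f x w -> is_surface_grad S g x w.
Proof.
move=> fg [tw gw]; split => // gamma v c; have [gS _ _] := c.
have -> : g \o gamma = f \o gamma by apply/funext => h /=; rewrite fg.
exact: gw.
Qed.

Lemma is_surface_grad_cst (k : R) x : S x -> is_surface_grad S (cst k) x 0.
Proof.
move=> Sx; split; first by apply/tangent_esphere => //; rewrite dotpC dotp0l.
move=> gamma v c; rewrite dotp0l.
have -> : cst k \o gamma = cst k by apply/funext.
exact: is_derive_cst.
Qed.

Lemma surface_grad_cst (k : R) x : S x -> surface_grad S (cst k) x = 0.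
Proof. by move=> Sx; apply: is_surface_grad_unique => //; exact: is_surface_grad_cst. Qed.

(** The field [surface_grad S (cst k)] is zero on the sphere but unspecified
elsewhere; hence the recourse to [eq_is_surface_grad], here and below. *)
Lemma surface_grad_cst_differentiable (k : R) :
  surface_differentiable_field S (surface_grad S (cst k)).
Proof.
move=> i x Sx; exists 0.
apply: (@eq_is_surface_grad (cst 0)); last exact: is_surface_grad_cst.
by move=> y Sy; rewrite surface_grad_cst// mxE.
Qed.

Lemma laplace_beltrami_cst (k : R) x : S x ->
  laplace_beltrami S (cst k) x = 0.
Proof.
move=> Sx; rewrite /laplace_beltrami /surface_div big1// => i _.
rewrite (_ : surface_grad _ _ _ = 0) ?mxE//.
apply: is_surface_grad_unique => //.
apply: (@eq_is_surface_grad (cst 0)); last exact: is_surface_grad_cst.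
by move=> y Sy; rewrite surface_grad_cst// mxE.
Qed.

(** A unit vector orthogonal to the tangent space is [x / r] or [- x / r]; the
second one points into the ball. *)
Lemma is_outer_unit_normal_esphereP x n : S x ->
  is_outer_unit_normal (eball r) S x n <-> n = r^-1 *: x.
Proof.
move=> Sx; have xx := (esphereP x).1 Sx; have rn0 : r != 0 by rewrite gt_eqF.
split.
  move=> [n1 nt [e e0 he]].
  pose a := r ^- 2 * dotp n x.
  have nE : n = a *: x.
    apply/eqP; rewrite -subr_eq0; apply/eqP/dotpp_eq0.
    have ort : dotp x (n - a *: x) = 0.
      by rewrite dotpBr dotpZr xx /a [dotp n x]dotpC mulrC mulVKf ?subrr// expf_neq0.
    rewrite dotpBl dotpZl ort mulr0 subr0; apply: nt.
    exact/tangent_esphere.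
  have : `|a| * r = 1 by move: n1; rewrite nE enormZ Sx.
  have [a0 ar|a0 ar] := ger0P a; rewrite nE; congr (_ *: _).
    by rewrite -[a](mulfK rn0) ar mul1r.
  (* Inward normal: a step of length at most [r] along it stays in the ball. *)
  exfalso; have h0 : 0 < Num.min (e / 2) r by rewrite lt_min r0 divr_gt0.
  set h := Num.min (e / 2) r in h0.
  have hle : h < e by rewrite gt_min; apply/orP; left; lra.
  have hr : h <= r by rewrite ge_min lexx orbT.
  apply: (he h); first by rewrite h0.
  rewrite /eball /= nE scalerA -[X in X + _]scale1r -scalerDl enormZ Sx.
  have haE : h * a * r = - h by rewrite -mulrA -[a]opprK mulNr ar mulrN1.
  rewrite -[X in _ * X]ger0_norm ?ltW// -normrM mulrDl mul1r haE ger0_norm; lra.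
move=> ->; split.
- by rewrite enormZ Sx gtr0_norm ?invr_gt0// mulVf.
- by move=> v /(tangent_esphere _ Sx) xv; rewrite dotpZl xv mulr0.
- exists 1 => // h /andP[h0 _]; rewrite /eball /= scalerA -[X in X + _]scale1r.
  rewrite -scalerDl enormZ Sx.
  rewrite -[X in _ * X]ger0_norm ?ltW// -normrM mulrDl mul1r divfK//.
  by apply/negP; rewrite -leNgt ger0_norm ?lerDl ?addr_ge0 ?ltW.
Qed.

Lemma outer_unit_normal_esphere x : S x ->
  outer_unit_normal (eball r) S x = r^-1 *: x.
Proof.
move=> Sx; apply: get_unique; first exact/is_outer_unit_normal_esphereP.
by move=> n /(is_outer_unit_normal_esphereP _ Sx).
Qed.

(** On the sphere the [i]-th component of the normal is the linear function
[y i / r], whose surface gradient is the tangential part of [e_i / r]. *)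
Lemma is_surface_grad_normal i x : S x ->
  is_surface_grad S (fun y => outer_unit_normal (eball r) S y 0 i) x
    (r^-1 *: (delta_mx 0 i - (x 0 i / r ^+ 2) *: x)).
Proof.
move=> Sx; have xx := (esphereP x).1 Sx; have rn0 : r != 0 by rewrite gt_eqF.
apply: (@eq_is_surface_grad (fun y => r^-1 * y 0 i)).
  by move=> y Sy; rewrite outer_unit_normal_esphere// mxE.
split.
  apply/tangent_esphere => //.
  rewrite dotpZr dotpBr dotpZr xx [dotp x _]dotpC dotp_delta divfK ?subrr ?mulr0//.
  exact: expf_neq0.
move=> gamma v c; have [_ _ /is_derive_rowP dg] := c.
have /(tangent_esphere _ Sx) xv : tangent S x v by exists gamma.
have -> : (fun y : E => r^-1 * y 0 i) \o gamma = r^-1 \*: (fun h => gamma h 0 i) by [].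
rewrite dotpZl dotpBl dotpZl xv mulr0 subr0 dotp_delta.
exact: is_deriveZ.
Qed.

(** The surface divergence of [x / r] is [1 / r] times the trace of the tangential
projection, which is the dimension [d] of the tangent space. *)
Lemma mean_curvature_esphere x : S x ->
  mean_curvature (eball r) S x = - (d%:R / r).
Proof.
move=> Sx; have xx := (esphereP x).1 Sx; have rn0 : r != 0 by rewrite gt_eqF.
rewrite /mean_curvature /surface_div; congr (- _).
transitivity (\sum_(i < d.+1) (r^-1 - r^-1 * (r ^- 2 * (x 0 i * x 0 i)))).
  apply: eq_bigr => i _.
  rewrite (is_surface_grad_unique Sx (is_surface_grad_normal i Sx)) !mxE !eqxx/=.
  by ring.
rewrite sumrB sumr_const card_ord -!mulr_sumr -/(dotp x x) xx.
by rewrite -[_ *+ d.+1]mulr_natr -natr1; field.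
Qed.

End SphereCalculus.

(** * Derivatives in time *)

Section OneSidedDerivative.
Context (R : realType) (V : normedModType R).
Implicit Types (f : R -> V) (t : R) (df : V).

(** Positive increments are always admissible, so limits of time quotients are
unique, also at [t = 0]. *)
Lemma time_filter_proper t : 0 <= t ->
  ProperFilter (within [set h : R | 0 <= t + h] (0 : R)^').
Proof.
move=> t0; apply: Build_ProperFilter => //= => /nbhs_ballP[e /= e0 He].
apply: (He (e / 2)) => /=.
- by rewrite /ball/= sub0r normrN gtr0_norm ?divr_gt0//; lra.
- by rewrite gt_eqF// divr_gt0.
- by rewrite addr_ge0// ltW// divr_gt0.
Qed.

Lemma is_derive_time_quotients f t df :
  is_derive t (1 : R) f df -> time_quotients f t --> df.
Proof.
move=> [dfx <-]; rewrite /time_quotients.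
have -> : (fun h : R => h^-1 *: (f (t + h) - f t)) =
    (fun h : R => h^-1 *: ((f \o shift t) (h *: (1 : R)) - f t)).
  by apply/funext => h /=; congr (_ *: (f _ - _)); rewrite /GRing.scale/= mulr1 addrC.
apply: cvg_trans dfx; apply: cvg_app.
exact: cvg_within.
Qed.

Lemma is_derive_time_derivable f t df :
  is_derive t (1 : R) f df -> time_derivable f t.
Proof. by move=> /is_derive_time_quotients fdf; apply/cvg_ex; exists df. Qed.

Lemma is_derive_time_derive f t df : 0 <= t ->
  is_derive t (1 : R) f df -> time_derive f t = df.
Proof.
move=> t0 /is_derive_time_quotients fdf.
have pf := time_filter_proper t0.
by apply: (cvg_lim _ fdf); exact: norm_hausdorff.
Qed.

End OneSidedDerivative.

Lemma is_derive_scalel (R : realType) (n : nat) (f : R -> R) (z : 'rV[R]_n)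
    (t df : R) :
  is_derive t (1 : R) f df -> is_derive t (1 : R) (fun u => f u *: z) (df *: z).
Proof.
move=> ffd; apply/is_derive_rowP => i.
have -> : (fun u => (f u *: z) 0 i) = z 0 i \*: f.
  by apply/funext => u; rewrite !mxE /= /GRing.scale /= mulrC.
by apply: is_derive_eq; rewrite mxE /GRing.scale /= mulrC.
Qed.

(** * The radius and the evolution *)

(** Separating variables in [r' = - A * r ^ (q + 1)] gives
[(r ^ (- q))' = A * q], whence [b t = r t ^ (- q)] is affine.  The solution extends
to a neighbourhood of each [t >= 0], so its derivatives are two-sided. *)
Lemma radius_ode_global_solution (R : realType) (d : nat) (k R0 s : R) :
  (1 <= d)%N -> 0 < k -> 0 < R0 -> s < - (2 / d%:R) ->
  exists r : R -> R, [/\ r 0 = R0, forall t : R, 0 <= t -> 0 < r t &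
    forall t : R, 0 <= t ->
      is_derive t (1 : R) r ((k * r t ^- d) `^ s * - (d%:R / r t))].
Proof.
move=> d1 k0 R00 hs; have dR0 : 0 < d%:R :> R by rewrite ltr0n.
pose q := - (d%:R * s) - 2.
have q0 : 0 < q.
  by move: hs; rewrite -mulNr ltr_pdivlMr// /q mulrC; lra.
have qn0 : q != 0 by rewrite gt_eqF.
pose A := d%:R * k `^ s.
have A0 : 0 < A by rewrite mulr_gt0// powR_gt0.
pose b t := R0 `^ (- q) + A * q * t.
have b0 (t : R) : 0 <= t -> 0 < b t.
  by move=> t0; rewrite ltr_wpDr ?powR_gt0// mulr_ge0// mulr_ge0 ?ltW.
pose r t := b t `^ (- q^-1).
have r0 (t : R) : 0 <= t -> 0 < r t by move=> t0; rewrite powR_gt0// b0.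
exists r; split => // [|t t0].
  by rewrite /r /b mulr0 addr0 -powRrM mulrNN mulfV// powRr1 ?ltW.
have rt := r0 t t0; have bt := b0 t t0.
have db : is_derive t (1 : R) b (A * q).
  have -> : b = cst (R0 `^ (- q)) + (A * q) \*: @id R by apply/funext => h.
  by apply: is_derive_eq; rewrite /GRing.scale/= mulr1 add0r.
have dp := is_derive1_powR (- q^-1) bt.
apply: (is_derive_eq (is_derive1_comp dp db)).
have bE : b t = r t `^ (- q) by rewrite /r -powRrM mulrNN mulVf// powRr1// ltW.
have powD (x y : R) : r t `^ (x + y) = r t `^ x * r t `^ y.
  by rewrite powRD// (gt_eqF rt) implybT.
have -> : b t `^ (- q^-1 - 1) = r t `^ q * r t.
  rewrite bE -powRrM (_ : r t `^ q * r t = r t `^ (q + 1)).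
    by congr (_ `^ _); field.
  by rewrite (powD q 1) powRr1 ?ltW.
have -> : (k * r t ^- d) `^ s = k `^ s * (r t `^ q * r t ^+ 2).
  rewrite powRM ?invr_ge0 ?exprn_ge0 ?ltW//; congr (_ * _).
  rewrite -powR_mulrn ?ltW// -powRN -powRrM -powR_mulrn ?ltW// -powD.
  by congr (_ `^ _); rewrite /q; ring.
rewrite /A; field.
by rewrite gt_eqF// qn0.
Qed.

Theorem theorem3p4 (R : realType) (d : nat) (m R0 s alpha : R)
    (hd : (1 <= d)%N) (hm : 0 < m) (hR0 : 0 < R0)
    (hs : s < - (2 / d%:R)) (halpha : 0 < alpha) :
  exists r : R -> R,
    [/\ r 0 = R0,
        forall t, 0 <= t -> 0 < r t &
        @global_solution R d (Gdens s alpha)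
          (esphere R0)
          (fun t => eball (r t))
          (fun t => esphere (r t))
          (fun t z => (r t / R0) *: z)
          (fun t _ => m / sphere_area R d * r t ^- d)].
Proof.
have k0 : 0 < m / sphere_area R d by rewrite divr_gt0// sphere_area_gt0.
set k := m / sphere_area R d in k0 *.
have [r [r00 rgt0 dr]] := radius_ode_global_solution hd k0 hR0 hs.
have s0 : s < 0.
  by rewrite (lt_trans hs)// oppr_lt0 divr_gt0// ltr0n.
have R0n : R0 != 0 by rewrite gt_eqF.
exists r; split => //.
pose M := @esphere R d.+1 R0.
pose theta (t : R) (z : 'rV[R]_d.+1) := (r t / R0) *: z.
pose c (t : R) (z : 'rV[R]_d.+1) := k * r t ^- d.
change (global_solution (Gdens s alpha) M (fun t => eball (r t))
  (fun t => esphere (r t)) theta c).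
have thetaS (t : R) z : 0 <= t -> M z -> esphere (r t) (theta t z).
  move=> t0 Mz; rewrite /esphere /= /theta enormZ Mz.
  by rewrite gtr0_norm ?divfK// divr_gt0// rgt0.
pose V t := (k * r t ^- d) `^ s * - (d%:R / r t).
have dtheta (t : R) z : 0 <= t ->
    is_derive t (1 : R) (fun u => theta u z) ((V t / R0) *: z).
  move=> t0; apply: is_derive_scalel; have drt := dr t t0.
  have -> : (fun u => r u / R0) = R0^-1 \*: r.
    by apply/funext => u; rewrite /GRing.scale /= mulrC.
  by apply: is_derive_eq; rewrite /GRing.scale /= mulrC.
(* Conservation of mass: [c] is proportional to [r ^- d], so [c' / c = - d r' / r]
   for any velocity [r']; this is the diffusion equation. *)
have dc (t : R) z : 0 <= t -> is_derive t (1 : R) (fun u => c u z)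
    (c t z * - (d%:R / r t) * V t).
  move=> t0; have drt := dr t t0; have rt := rgt0 t t0.
  have rn : r t != 0 by rewrite gt_eqF.
  have rdn : (r ^+ d) t != 0 by rewrite fctE expf_neq0.
  have -> : (fun u => c u z) = k \*: (fun u => ((r ^+ d) u)^-1).
    by apply/funext => u; rewrite /= fctE.
  have dV := is_deriveV rdn (is_deriveX d drt).
  apply: is_derive_eq; rewrite /c /GRing.scale /= -/(V t).
  case: (d) hd => // e _; rewrite fctE /= !exprS; field.
  by rewrite rn expf_neq0.
have vel (t : R) z : 0 <= t -> total_velocity theta t z = (V t / R0) *: z.
  by move=> t0; exact: is_derive_time_derive (dtheta t z t0).
have curv (t : R) z : 0 <= t -> M z ->
    curvature (fun t => eball (r t)) (fun t => esphere (r t)) theta t z =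
    - (d%:R / r t).
  by move=> t0 Mz; apply: mean_curvature_esphere; [exact: rgt0|exact: thetaS].
have nvel (t : R) z : 0 <= t -> M z ->
    normal_velocity (fun t => eball (r t)) (fun t => esphere (r t)) theta t z =
    V t.
  move=> t0 Mz; have rn : r t != 0 by rewrite gt_eqF// rgt0.
  rewrite /normal_velocity vel// /normal outer_unit_normal_esphere ?rgt0//.
    rewrite /theta !(dotpZl, dotpZr) ((esphereP hR0 z).1 Mz).
    by field; rewrite rn R0n.
  exact: thetaS.
constructor.
- move=> t t0; have rt := rgt0 t t0; split.
  + by move=> z; exact: thetaS.
  + move=> x y _ _; apply: scalerI.
    by rewrite mulf_neq0 ?invr_eq0// gt_eqF.
  + move=> x Sx; exists ((R0 / r t) *: x).
      rewrite /M /esphere /= enormZ Sx gtr0_norm ?divfK ?divr_gt0//.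
      by rewrite gt_eqF.
    by rewrite /theta scalerA mulrA divfK// divff ?scale1r// gt_eqF.
- by move=> z _; rewrite /theta r00 divff// scale1r.
- move=> t x t0 Sx; exists ((r t)^-1 *: x).
  by apply/(is_outer_unit_normal_esphereP (rgt0 t t0)).
- move=> t t0 i x Sx; eexists.
  exact: is_surface_grad_normal (rgt0 t t0) i x Sx.
- by move=> t z t0 _; exact: is_derive_time_derivable (dtheta t z t0).
- by move=> t z t0 _; rewrite /c divr_gt0// exprn_gt0// rgt0.
- by move=> t z t0 _; exact: is_derive_time_derivable (dc t z t0).
- move=> t t0 x Sx; exists 0.
  exact: is_surface_grad_cst (rgt0 t t0) (k * r t ^- d) _ Sx.
- move=> t t0 x Sx; exists 0.
  exact: is_surface_grad_cst (rgt0 t t0)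
    (derive1 (Gdens s alpha) (k * r t ^- d)) _ Sx.
- by move=> t t0; exact: surface_grad_cst_differentiable (rgt0 t t0)
    (derive1 (Gdens s alpha) (k * r t ^- d)).
- move=> t z t0 Mz; rewrite nvel// curv// gfun_Gdens//.
  by rewrite /c divr_gt0// exprn_gt0// rgt0.
- move=> t z t0 Mz; rewrite nvel// curv// /normal_time_derive.
  have -> : grad_at M (fun t => esphere (r t)) theta t (c t) z = 0.
    exact: surface_grad_cst (rgt0 t t0) (k * r t ^- d) _ (thetaS t z t0 Mz).
  have -> : laplace_at M (fun t => esphere (r t)) theta t
      (derive1 (Gdens s alpha) \o c t) z = 0.
    exact: laplace_beltrami_cst (rgt0 t t0)
      (derive1 (Gdens s alpha) (k * r t ^- d)) _ (thetaS t z t0 Mz).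
  rewrite dotpC dotp0l subr0 add0r.
  exact: is_derive_time_derive (dc t z t0).
Qed.
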